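(* Let $(\Omega,\Sigma,\mu)$ be a measure space and let $X$ be a closed linear subspace of $L_1(\mu)$. Then every extreme point of the closed unit ball $B_X$ is preserved, i.e. is also an extreme point of the closed unit ball $B_{X^{**}}$ of the bidual.
   Context: All Banach spaces are real. $B_X$ denotes the closed unit ball of a Banach space $X$, and $X$ is identified with its canonical image in $X^{**}$. An extreme point of $B_X$ is called preserved if it is also an extreme point of $B_{X^{**}}$. *)

(* Defs.v *)
From HB Require Import structures.
From mathcomp Require Import all_boot all_order all_algebra.
From mathcomp Require Import all_classical all_reals all_analysis.
From mathcomp Require Import measurable_realfun.

Set Implicit Arguments.
Unset Strict Implicit.
Unset Printing Implicit Defensive.

Import Order.TTheory GRing.Theory Num.Theory.
Import numFieldNormedType.Exports.

Local Open Scope classical_set_scope.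
Local Open Scope ring_scope.

Section extreme.
Context {R : realType}.

Definition unit_ball (V : normedModType R) : set V := [set x | `|x| <= 1].

Definition extreme_point (V : lmodType R) (A : set V) (x : V) : Prop :=
  A x /\ forall (y z : V) (t : R), A y -> A z -> 0 < t -> t < 1 ->
    x = t *: y + (1 - t) *: z -> y = x /\ z = x.

End extreme.
Arguments unit_ball {R} V _.

Section dual.
Context {R : realType} (V : normedModType R).

Definition dual_set : set (V -> R^o) := [set f | linear f /\ continuous f].
Definition dual_pred : {pred V -> R^o} := mem dual_set.

Lemma dual_predP (f : V -> R^o) : (f \in dual_pred) = (f \in dual_set).
Proof. by []. Qed.

Lemma dual_submod_closed : submod_closed dual_pred.
Proof.
split=> [|a f g].
  rewrite dual_predP inE; split; last exact: cst_continuous.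
  by move=> a x y; rewrite /= scaler0 addr0.
rewrite !dual_predP !inE => -[lf cf] [lg cg]; split.
  move=> b x y; rewrite /GRing.add /GRing.scale /= lf lg /GRing.scale /=.
  by rewrite !mulrDr addrACA (mulrCA a b).
move=> x; apply: (@continuousD _ _ _ (a \*: f) g); last exact: cg.
exact: (continuousZl_tmp (cf x)).
Qed.
HB.instance Definition _ :=
  GRing.isSubmodClosed.Build R (V -> R^o) dual_pred dual_submod_closed.

Record dual := Dual { dual_val :> V -> R^o; _ : dual_val \in dual_pred }.

HB.instance Definition _ := [isSub for dual_val].
HB.instance Definition _ := gen_eqMixin dual.
HB.instance Definition _ := gen_choiceMixin dual.
HB.instance Definition _ := [SubChoice_isSubLmodule of dual by <:].

Lemma dual_linear (f : dual) : linear f.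
Proof. by case: f => f /=; rewrite dual_predP inE => -[]. Qed.

HB.instance Definition _ (f : dual) :=
  GRing.isLinear.Build R V R^o *:%R f (dual_linear f).

Lemma dual_continuous (f : dual) : continuous f.
Proof. by case: f => f /=; rewrite dual_predP inE => -[]. Qed.

Lemma dual_ext (f g : dual) : f =1 g -> f = g.
Proof. by move=> fg; apply/val_inj/funext. Qed.

Definition op_norm (f : dual) : R := sup [set `|f x| | x in unit_ball V].

Lemma op_norm_has_sup (f : dual) : has_sup [set `|f x| | x in unit_ball V].
Proof.
split; first by exists `|f 0|; exists 0 => //; rewrite /unit_ball/= normr0.
have f0 : {for 0, continuous f} by apply: dual_continuous.
have /linear_boundedP[M [Mr fM]] := continuous_linear_bounded 0 f0.
exists `|M + 1|=> _ [x x1 <-].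
rewrite (le_trans (fM (M + 1) _ x)) ?ltrDl//.
rewrite (le_trans (ler_wpM2r _ (ler_norm _)))//.
by rewrite ler_piMr.
Qed.

Lemma op_norm_ub (f : dual) x : `|x| <= 1 -> `|f x| <= op_norm f.
Proof. by move=> x1; apply: sup_upper_bound; [exact: op_norm_has_sup|exists x]. Qed.

Lemma op_norm_le (f : dual) (c : R) :
  (forall x, `|x| <= 1 -> `|f x| <= c) -> op_norm f <= c.
Proof.
move=> fc; apply: sup_le_ub; first by have [] := op_norm_has_sup f.
by move=> _ [x x1 <-]; exact: fc.
Qed.

Lemma op_norm_ge0 (f : dual) : 0 <= op_norm f.
Proof. by rewrite (le_trans _ (@op_norm_ub f 0 _))// normr0. Qed.

Lemma op_normP (f : dual) x : `|f x| <= op_norm f * `|x|.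
Proof.
have [->|x0] := eqVneq x 0; first by rewrite linear0 !normr0 mulr0.
have nx : 0 < `|x| by rewrite normr_gt0.
rewrite -ler_pdivrMr//.
have -> : `|f x| / `|x| = `|f (`|x|^-1 *: x)|.
  by rewrite linearZ normrZ normfV normr_id mulrC.
by apply: op_norm_ub; rewrite normrZ normfV normr_id mulVf ?gt_eqF.
Qed.

Lemma op_normD (f g : dual) : op_norm (f + g) <= op_norm f + op_norm g.
Proof.
apply: op_norm_le => x x1.
by rewrite (le_trans (ler_normD _ _))// lerD// op_norm_ub.
Qed.

Lemma op_normZ_le (a : R) (f : dual) : op_norm (a *: f) <= `|a| * op_norm f.
Proof.
apply: op_norm_le => x x1.
by rewrite [leLHS]normrM ler_wpM2l// op_norm_ub.
Qed.

Lemma op_normZ (a : R) (f : dual) : op_norm (a *: f) = `|a| * op_norm f.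
Proof.
apply/eqP; rewrite eq_le op_normZ_le /=.
have [->|a0] := eqVneq a 0; first by rewrite normr0 mul0r op_norm_ge0.
rewrite -ler_pdivlMl ?normr_gt0// -normfV -{1}(scale1r f) -(mulVf a0) -scalerA.
exact: op_normZ_le.
Qed.

Lemma op_norm_eq0 (f : dual) : op_norm f = 0 -> f = 0.
Proof.
move=> f0; apply: dual_ext => x; apply/eqP.
by rewrite -normr_le0 (le_trans (op_normP f x))// f0 mul0r.
Qed.

HB.instance Definition _ :=
  Lmodule_isNormed.Build R dual op_normD op_normZ op_norm_eq0.

End dual.
Arguments dual {R} V.
Arguments dual_set {R} V _.
Arguments dual_pred {R} V _.

Section bidual.
Context {R : realType} (V : normedModType R).

Definition bidual := dual (dual V).
HB.instance Definition _ := NormedModule.on bidual.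

Definition evaluation (x : V) (f : dual V) : R^o := f x.

Lemma evaluation_linear x : linear (evaluation x).
Proof. by []. Qed.

Lemma evaluation_in_dual x : evaluation x \in dual_pred (dual V).
Proof.
rewrite dual_predP inE; split; first exact: evaluation_linear.
pose h := GRing.isLinear.Build R (dual V) R^o *:%R _ (evaluation_linear x).
pose e : {linear dual V -> R^o} := HB.pack (evaluation x) h.
apply: (@bounded_linear_continuous _ _ _ e); apply/linear_boundedP.
exists `|x|; split; first exact: num_real.
move=> r xr f; rewrite (le_trans (op_normP f x))//.
by rewrite mulrC ler_wpM2r ?op_norm_ge0// ltW.
Qed.

Definition to_bidual (x : V) : bidual := Dual (evaluation_in_dual x).

Definition preserved_extreme_point (x : V) : Prop :=
  extreme_point (unit_ball V) x /\
  extreme_point (unit_ball bidual) (to_bidual x).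

End bidual.

Section subspace.
Context {R : realType} (V : normedModType R) (X : submodClosed V).

Record subspace_of := SubspaceOf { subspace_val :> V; _ : subspace_val \in X }.

HB.instance Definition _ := [isSub for subspace_val].
HB.instance Definition _ := [Choice of subspace_of by <:].
HB.instance Definition _ := [SubChoice_isSubLmodule of subspace_of by <:].

Let norm (x : subspace_of) : R := `|val x|.

Let ler_normD x y : norm (x + y) <= norm x + norm y.
Proof. by rewrite /norm raddfD/= ler_normD. Qed.

Let normrZ a x : norm (a *: x) = `|a| * norm x.
Proof. by rewrite /norm linearZ/= normrZ. Qed.

Let normr0_eq0 x : norm x = 0 -> x = 0.
Proof. by move=> /normr0_eq0 x0; apply/val_inj; rewrite x0 raddf0. Qed.

HB.instance Definition _ :=
  Lmodule_isNormed.Build R subspace_of ler_normD normrZ normr0_eq0.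

End subspace.

Section L1.
Context d (T : measurableType d) (R : realType).
Variable mu : {measure set T -> \bar R}.

(* [LspaceType1] has no algebraic or normed structure in the library: an element
   is a class of measurable functions modulo a.e. equality whose chosen
   representative [repr] has finite 1-norm. The operations below are computed on
   representatives; [L1_classD], [L1_classN], [L1_classZ] and [L1_norm_class]
   show that they do not depend on this choice. *)
Definition L1 : Type := LspaceType1 mu.

HB.instance Definition _ := gen_eqMixin L1.
HB.instance Definition _ := gen_choiceMixin L1.

Local Notation L1fun := (LfunType mu (@lexx _ _ (1%E : \bar R))).

Definition L1_to_fun (u : L1) : T -> R := repr (LebesgueSpace.sort u).

Lemma L1_to_fun_in (u : L1) : L1_to_fun u \in Lfun mu 1.
Proof.
case: u => u [[ufin]]; apply/andP; split; rewrite inE//=.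
exact: (@measurable_funPT _ _ _ _ (repr u)).
Qed.

Definition L1_rep (u : L1) : L1fun := Lfun_Sub _ (L1_to_fun_in u).

(* [LspaceType1] takes values in [measurableTypeR R], the type [R] with its
   canonical Borel structure, whereas [LfunType] takes values in [R] itself. *)
Definition L1fun_mfun (f : L1fun) : {mfun T >-> measurableTypeR R} :=
  HB.pack (f : T -> measurableTypeR R)
    (isMeasurableFun.Build _ _ T (measurableTypeR R) f (@measurable_funPT _ _ _ _ f)).

Definition mfun_class (f : L1fun) : {mfun_ mu, T >-> measurableTypeR R} :=
  (\pi_({mfun_ mu, T >-> measurableTypeR R}) (L1fun_mfun f))%qT.

Lemma mfun_classE (f : L1fun) :
  (repr (mfun_class f) : T -> R) = f %[ae mu].
Proof.
have : (repr (mfun_class f) = L1fun_mfun f %[mod {mfun_ mu, T >-> measurableTypeR R}])%qT.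
  by rewrite reprK.
by move/eqmodP => /asboolP.
Qed.

Lemma ae_eq_Lnorm1 (f g : T -> R) : measurable_fun setT f ->
  measurable_fun setT g -> f = g %[ae mu] ->
  'N[mu]_1[EFin \o f]%E = 'N[mu]_1[EFin \o g]%E.
Proof.
move=> mf mg fg; rewrite !Lnorm1; apply: ae_eq_integral => //.
- by apply/measurable_EFinP; exact: measurableT_comp.
- by apply/measurable_EFinP; exact: measurableT_comp.
- by apply: filterS fg => x /[apply] /= ->.
Qed.

Lemma mfun_class_finite (f : L1fun) : finite_norm mu 1 (mfun_class f).
Proof.
rewrite /finite_norm (ae_eq_Lnorm1 _ _ (mfun_classE f)).
- exact: Lfunction_finite.
- exact: (@measurable_funPT _ _ _ _ (repr (mfun_class f))).
- exact: (@measurable_funPT _ _ _ _ f).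
Qed.

Definition L1_class (f : L1fun) : L1 :=
  LebesgueSpace.Pack (LebesgueSpace.Class
   (isFinLebesgue.Axioms_ _ _ _ _ _ _ (mfun_class_finite f))).

Lemma L1_eq (u v : L1) : LebesgueSpace.sort u = LebesgueSpace.sort v -> u = v.
Proof.
case: u v => [u [[pu]]] [v [[pv]]] /= uv.
by case: _ / uv pv => pv; rewrite (Prop_irrelevance pu pv).
Qed.

Lemma L1_classP (f g : L1fun) :
  L1_class f = L1_class g <-> (f : T -> R) = g %[ae mu].
Proof.
split=> [fg|fg].
  have : mfun_class f = mfun_class g by exact: (congr1 (@LebesgueSpace.sort _ _ _ _ _ _) fg).
  by move/eqmodP => /asboolP.
by apply: L1_eq; apply/eqmodP/asboolP.
Qed.

Lemma L1_repK : cancel L1_rep L1_class.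
Proof.
move=> u; apply: L1_eq => /=; rewrite -[RHS]reprK; apply/eqmodP/asboolP.
exact: ae_eq_refl.
Qed.

Lemma L1_classK (f : L1fun) : (L1_rep (L1_class f) : T -> R) = f %[ae mu].
Proof. exact: mfun_classE. Qed.

Definition L1_add (u v : L1) : L1 := L1_class (L1_rep u + L1_rep v).
Definition L1_opp (u : L1) : L1 := L1_class (- L1_rep u).
Definition L1_scale (a : R) (u : L1) : L1 := L1_class (a *: L1_rep u).
Definition L1_norm (u : L1) : R := fine ('N[mu]_1[EFin \o L1_rep u])%E.

Lemma L1_classD f g : L1_add (L1_class f) (L1_class g) = L1_class (f + g).
Proof.
apply/L1_classP; move: (L1_classK f) (L1_classK g).
by apply: filterS2 => x /= /(_ I) fx /(_ I) gx _; congr (_ + _).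
Qed.

Lemma L1_classN f : L1_opp (L1_class f) = L1_class (- f).
Proof.
apply/L1_classP; move: (L1_classK f).
by apply: filterS => x /= /(_ I) fx _; congr (- _).
Qed.

Lemma L1_classZ a f : L1_scale a (L1_class f) = L1_class (a *: f).
Proof.
apply/L1_classP; move: (L1_classK f).
by apply: filterS => x /= /(_ I) fx _; congr (_ *: _).
Qed.

Lemma L1_norm_class (f : L1fun) : L1_norm (L1_class f) = fine ('N[mu]_1[EFin \o f])%E.
Proof.
by rewrite /L1_norm (ae_eq_Lnorm1 _ _ (L1_classK f)).
Qed.

Lemma L1_addA : associative L1_add.
Proof.
move=> u v w; rewrite -(L1_repK u) -(L1_repK v) -(L1_repK w).
by rewrite !L1_classD addrA.
Qed.

Lemma L1_addC : commutative L1_add.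
Proof. by move=> u v; rewrite /L1_add addrC. Qed.

Lemma L1_add0 : left_id (L1_class 0) L1_add.
Proof. by move=> u; rewrite -(L1_repK u) L1_classD add0r. Qed.

Lemma L1_addN : left_inverse (L1_class 0) L1_opp L1_add.
Proof. by move=> u; rewrite -(L1_repK u) L1_classN L1_classD addNr. Qed.

HB.instance Definition _ :=
  GRing.isZmodule.Build L1 L1_addA L1_addC L1_add0 L1_addN.

Lemma L1_scaleA a b u : L1_scale a (L1_scale b u) = L1_scale (a * b) u.
Proof. by rewrite -(L1_repK u) !L1_classZ scalerA. Qed.

Lemma L1_scale1 : left_id 1 L1_scale.
Proof. by move=> u; rewrite -(L1_repK u) L1_classZ scale1r. Qed.

Lemma L1_scaleDr : right_distributive L1_scale +%R.
Proof.
move=> a u v; rewrite -(L1_repK u) -(L1_repK v).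
by rewrite [in LHS]/GRing.add [in RHS]/GRing.add/= !(L1_classZ, L1_classD) scalerDr.
Qed.

Lemma L1_scaleDl u : {morph L1_scale^~ u : a b / a + b}.
Proof.
move=> a b; rewrite -(L1_repK u).
by rewrite [in RHS]/GRing.add/= !(L1_classZ, L1_classD) scalerDl.
Qed.

HB.instance Definition _ :=
  GRing.Zmodule_isLmodule.Build R L1 L1_scaleA L1_scale1 L1_scaleDr L1_scaleDl.

Lemma L1_normD (u v : L1) : L1_norm (u + v) <= L1_norm u + L1_norm v.
Proof. by rewrite [u + v]/(L1_add u v) L1_norm_class ler_LnormD. Qed.

Lemma L1_normZ a (u : L1) : L1_norm (a *: u) = `|a| * L1_norm u.
Proof.
rewrite [a *: u]/(L1_scale a u) L1_norm_class.
apply: EFin_inj; rewrite EFinM !finite_norm_fine.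
exact: LnormZ.
Qed.

Lemma L1_norm_eq0 (u : L1) : L1_norm u = 0 -> u = 0.
Proof.
move=> /fine_Lnormr_eq0 u0; rewrite -(L1_repK u).
exact/L1_classP.
Qed.

HB.instance Definition _ :=
  Lmodule_isNormed.Build R L1 L1_normD L1_normZ L1_norm_eq0.

End L1.

(* Main.v *)
Require Import Defs.
From HB Require Import structures.
From mathcomp Require Import all_boot all_order all_algebra.
From mathcomp Require Import all_classical all_reals all_analysis.
From mathcomp Require Import measurable_realfun.
From mathcomp Require Import ring lra.

Set Implicit Arguments.
Unset Strict Implicit.
Unset Printing Implicit Defensive.

Import Order.TTheory GRing.Theory Num.Theory.
Import numFieldNormedType.Exports.

Local Open Scope classical_set_scope.
Local Open Scope ring_scope.

(** The space [L1 mu] is an L-summand in its bidual, and the proof goes through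
    the part of that fact which concerns convex decompositions. Let [x] be an
    extreme point of the unit ball of [X]; unless [X] is 0, it has norm 1. Let
    [x = t y + (1 - t) z] with [0 < t < 1] and [y], [z] in the unit ball of
    [X**]. Composing [y] and [z] with the restriction [L1 mu* -> X*] gives
    elements [Y], [Z] of the unit ball of [L1 mu**]. Let [s] be the sign of [x],
    and for bounded measurable [h] let [pairing h] be the functional
    [u |-> int h u]. Since [1 = |x| = int s x] is a convex combination of the
    values of [Y] and [Z] at [pairing s], which are at most 1, both values are
    1. Two consequences follow.

    - Order domination ([convex_dominated]): for bounded measurable [k], the
      functional attached to [C s - s |k| + k] has norm at most [C] when
      [|k| <= C], whence [|Y (pairing k)| <= Y (pairing (s |k|))] and
      [t |Y (pairing k)| <= int |k x|]. A linear functional on the bounded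
      measurable functions dominated by [k |-> C int |k x|] has the form
      [k |-> int k g x] with [g] bounded ([bounded_density]). This is the
      Radon-Nikodym theorem on the support of [x], which is sigma-finite
      whatever [mu] is.

    - Localization ([norming_vanish]): [Y] vanishes at every functional that
      vanishes on all products [k x], since such a functional lives off the
      support of [x].

    A functional [Phi] on [L1 mu] agrees on the products [k x] with
    [pairing h] for some bounded [h], by [bounded_density] again. By
    localization [Y Phi = Y (pairing h) = int h g x = Phi (g x)]: thus [Y] is
    the element [w = g x] of [L1 mu] ([convex_component_in_L1]). In this way the
    dual of [L1 mu], which may differ from [L_infinity] when [mu] is not
    sigma-finite, never has to be described globally.

    Finally [w] lies in [X], because otherwise a functional vanishing on the
    closed subspace [X] but not at [w] would give [y 0 <> 0]; and every
    functional on [X] extends to [L1 mu], so that [y] is the evaluation at [w].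
    The same holds for [z], and extremality of [x] in the unit ball of [X]
    concludes. *)

(** * The Hahn-Banach theorem *)

Lemma bounded_linear_dual (R : realType) (V : normedModType R) (f : V -> R^o)
    (c : R) : 0 <= c -> linear f -> (forall v, `|f v| <= c * `|v|) ->
  exists2 phi : dual V, (forall v, phi v = f v) & `|phi| <= c.
Proof.
move=> c0 f_lin fc.
have f_dual : f \in dual_pred V.
  rewrite dual_predP inE; split => //.
  pose h := GRing.isLinear.Build R V R^o *:%R _ f_lin.
  pose e : {linear V -> R^o} := HB.pack f h.
  apply: (@bounded_linear_continuous _ _ _ e); apply/linear_boundedP.
  exists c; split; first exact: num_real.
  move=> r cr v; rewrite (le_trans (fc v))//.
  by rewrite ler_wpM2r// ltW.
exists (Dual f_dual) => //; apply: op_norm_le => v v1.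
by rewrite (le_trans (fc v))// ler_piMr.
Qed.

(** A partially defined linear functional on [V] is represented by its graph,
    a set of pairs closed under linear combinations. That the graph is
    single-valued is then a consequence of domination by the norm. *)
Section hahn_banach.
Context (R : realType) (V : normedModType R) (c : R).
Implicit Type G : set (V * R).

Definition graph_linear G := forall a v r w s,
  G (v, r) -> G (w, s) -> G (a *: v + w, a * r + s).

Definition graph_dominated G := forall v r, G (v, r) -> r <= c * `|v|.

Lemma graph_scale G a v r : G (0, 0) -> graph_linear G -> G (v, r) ->
  G (a *: v, a * r).
Proof. by move=> G0 GL Gv; have := GL a _ _ _ _ Gv G0; rewrite !addr0. Qed.

Lemma graph_functional G v r s : G (0, 0) -> graph_linear G ->
  graph_dominated G -> G (v, r) -> G (v, s) -> r = s.
Proof.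
move=> G0 GL GD Gr Gs.
have le0 t : G (0, t) -> t <= 0 by move=> /GD; rewrite normr0 mulr0.
have := GL (-1) _ _ _ _ Gr Gs; have := GL (-1) _ _ _ _ Gs Gr.
by rewrite !scaleN1r !addNr !mulN1r => /le0 + /le0; lra.
Qed.

(** The value [al] given to the new vector [v0] must lie between the lower
    bounds [r - c |v - v0|] and the upper bounds [c |v + v0| - r]; each of the
    former is below each of the latter by domination at the sum of the two
    vectors. *)
Lemma extension_value G v0 : 0 <= c -> G (0, 0) -> graph_linear G ->
  graph_dominated G ->
  exists al, forall v r, G (v, r) ->
    r - c * `|v - v0| <= al /\ r + al <= c * `|v + v0|.
Proof.
move=> c0 G0 GL GD.
pose A := [set u | exists v r, G (v, r) /\ u = r - c * `|v - v0|].
have cross v r w s : G (v, r) -> G (w, s) ->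
    r - c * `|v - v0| <= c * `|w + v0| - s.
  move=> Gv Gw; have := GL 1 _ _ _ _ Gv Gw; rewrite scale1r mul1r => /GD.
  have := ler_normD (v - v0) (w + v0); rewrite addrACA addNr addr0.
  by move=> /(ler_wpM2l c0); rewrite mulrDr; lra.
have supA : has_sup A.
  split; first by exists (0 - c * `|0 - v0|), 0, 0.
  exists (c * `|0 + v0| - 0) => _ [v [r [Gv ->]]]; exact: cross.
exists (sup A) => v r Gv; split.
  by apply: sup_upper_bound => //; exists v, r.
rewrite addrC -lerBrDr; apply: sup_le_ub; first by case: supA.
by move=> _ [w [s [Gw ->]]]; exact: cross.
Qed.

Lemma graph_extend G v0 : 0 <= c -> G (0, 0) -> graph_linear G ->
  graph_dominated G ->
  exists H, [/\ G `<=` H, graph_linear H, graph_dominated H &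
    exists r, H (v0, r)].
Proof.
move=> c0 G0 GL GD; have [al alP] := extension_value v0 c0 G0 GL GD.
pose H := [set p | exists v r b, G (v, r) /\ p = (v + b *: v0, r + b * al)].
exists H; split.
- by move=> [v r] Gv; exists v, r, 0; rewrite scale0r mul0r !addr0.
- move=> a _ _ _ _ [v [r [b [Gv [-> ->]]]]] [w [s [b' [Gw [-> ->]]]]].
  exists (a *: v + w), (a * r + s), (a * b + b'); split; first exact: GL.
  by rewrite scalerDr scalerDl scalerA addrACA; congr pair; ring.
- move=> _ _ [v [r [b [Gv [-> ->]]]]].
  have [b0|b0|->] := ltgtP b 0; last by rewrite scale0r mul0r !addr0; exact: GD.
  (* The bounds on [al] at [v / |b|], multiplied by [|b|]. *)
  + have nb0 : 0 < - b by rewrite oppr_gt0.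
    have [+ _] := alP _ _ (graph_scale (- b)^-1 G0 GL Gv).
    move=> /(ler_wpM2l (ltW nb0)).
    have -> : v + b *: v0 = (- b) *: ((- b)^-1 *: v - v0).
      by rewrite scalerBr scalerA mulfV ?gt_eqF// scale1r scaleNr opprK.
    by rewrite mulrBr mulVKf ?gt_eqF// (mulrCA _ c) normrZ gtr0_norm//; lra.
  + have [_] := alP _ _ (graph_scale b^-1 G0 GL Gv).
    move=> /(ler_wpM2l (ltW b0)).
    have -> : v + b *: v0 = b *: (b^-1 *: v + v0).
      by rewrite scalerDr scalerA mulfV ?gt_eqF// scale1r.
    by rewrite mulrDr mulVKf ?gt_eqF// (mulrCA _ c) normrZ gtr0_norm.
- by exists al, 0, 0, 1; rewrite scale1r mul1r !add0r.
Qed.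

Lemma maximal_graph G : G (0, 0) -> graph_linear G -> graph_dominated G ->
  exists M, [/\ G `<=` M, graph_linear M, graph_dominated M &
    forall H, M `<=` H -> graph_linear H -> graph_dominated H -> H `<=` M].
Proof.
move=> G0 GL GD.
(* The empty chain has the empty set as its union, whence the guard. *)
pose P M := M !=set0 -> [/\ G `<=` M, graph_linear M & graph_dominated M].
have [F FP Ftot|M [PM Mmax]] := @Zorn_bigcup _ P.
  move=> [p0 [M0 FM0 M0p0]].
  have adm M p : F M -> M p ->
      [/\ G `<=` M, graph_linear M & graph_dominated M].
    by move=> FM Mp; apply: (FP M FM); exists p.
  split.
  - move=> p Gp; exists M0 => //; have [GM _ _] := adm _ _ FM0 M0p0; exact: GM.
  - move=> a v r w s [M FM Mv] [N FN Nw].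
    have [MN|NM] := Ftot _ _ FM FN.
    + exists N => //; have [_ NL _] := adm _ _ FN Nw.
      by apply: NL => //; exact: MN.
    + exists M => //; have [_ ML _] := adm _ _ FM Mv.
      by apply: ML => //; exact: NM.
  - by move=> v r [M FM Mv]; have [_ _] := adm _ _ FM Mv; exact.
have M_neq0 : M !=set0.
  apply: contrapT => M0; apply: (Mmax G); last by move=> _; split.
  split; first by move=> p Mp; case: M0; exists p.
  by move=> GM; apply: M0; exists (0, 0); exact: GM.
have [GM ML MD] := PM M_neq0.
exists M; split => // H MH HL HD; apply: contrapT => nHM.
apply: (Mmax H) => // _; split => //; exact: subset_trans MH.
Qed.

(** A maximal dominated linear graph is the graph of the extension: it is
    single-valued by domination, and total because it cannot be extended by one
    dimension. *)
Theorem hahn_banach G : 0 <= c -> G (0, 0) -> graph_linear G ->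
  graph_dominated G ->
  exists phi : dual V, (forall v r, G (v, r) -> phi v = r) /\
    `|phi| <= c.
Proof.
move=> c0 G0 GL GD; have [M [GM ML MD Mmax]] := maximal_graph G0 GL GD.
have M0 : M (0, 0) by exact: GM.
have Mtot v : exists r, M (v, r).
  have [H [MH HL HD [r Hr]]] := graph_extend v c0 M0 ML MD.
  by exists r; exact: (Mmax H).
pose f v : R^o := projT1 (cid (Mtot v)).
have fP v : M (v, f v) by rewrite /f; case: cid.
have fE v r : M (v, r) -> f v = r.
  by move=> Mv; exact: (graph_functional M0 ML MD (fP v)).
have f_lin : linear f by move=> a v w; apply: fE; exact: ML.
have f_dom v : `|f v| <= c * `|v|.
  rewrite ler_norml (MD _ _ (fP v)) andbT lerNl -normrN.
  by apply: MD; have := graph_scale (-1) M0 ML (fP v); rewrite scaleN1r mulN1r.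
have [phi phiE phi_c] := bounded_linear_dual c0 f_lin f_dom.
by exists phi; split => // v r /GM; rewrite phiE; exact: fE.
Qed.

End hahn_banach.

(** * Duality of a normed space and of its subspaces *)

Section duality.
Context (R : realType) (V : normedModType R).
Implicit Types (v w : V) (X : submodClosed V).

(** Extension of [a *: v |-> a * |v|] from the line spanned by [v]. *)
Lemma norming_functional v : exists2 phi : dual V, `|phi| <= 1 & phi v = `|v|.
Proof.
pose G := [set p : V * R | exists a, p = (a *: v, a * `|v|)].
have [|||phi [phiE phi1]] := @hahn_banach R V 1 G ler01.
- by exists 0; rewrite scale0r mul0r.
- move=> a _ _ _ _ [b [-> ->]] [b' [-> ->]]; exists (a * b + b').
  by rewrite scalerDl scalerA; congr pair; ring.
- move=> _ _ [a [-> ->]]; rewrite mul1r normrZ ler_wpM2r//; exact: ler_norm.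
by exists phi => //; apply: phiE; exists 1; rewrite scale1r mul1r.
Qed.

Lemma to_bidual_inj : injective (@to_bidual R V).
Proof.
move=> v w vw; have [phi _ phiE] := norming_functional (v - w).
apply/eqP; rewrite -subr_eq0 -normr_eq0 -phiE raddfB /= subr_eq0; apply/eqP.
by have := congr1 (fun F : bidual V => F phi) vw.
Qed.

Lemma norm_to_bidual v : `|to_bidual v| = `|v|.
Proof.
apply/eqP; rewrite eq_le; apply/andP; split.
  apply: op_norm_le => phi phi1; rewrite (le_trans (op_normP phi v))//.
  by rewrite ler_piMl.
have [phi phi1 <-] := norming_functional v.
rewrite (le_trans (ler_norm _))//.
exact: (@op_norm_ub _ _ (to_bidual v) phi phi1).
Qed.

(** Extension of [v + a *: w |-> a], for [v] in [X]: it is bounded by the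
    inverse of the radius [e] of a ball around [w] that misses [X]. *)
Lemma separating_functional X w : closed [set` X] -> w \notin X ->
  exists2 Phi : dual V, (forall v, v \in X -> Phi v = 0) & Phi w = 1.
Proof.
move=> cX wX.
have [e /= e0 eX] : exists2 e : R, 0 < e & forall v, v \in X -> e <= `|w - v|.
  have : nbhs w (~` [set` X]).
    by apply: open_nbhs_nbhs; split; [exact: closed_openC|exact/negP].
  move=> /nbhs_ballP[e e0 eX]; exists e => // v vX.
  rewrite leNgt; apply/negP => we.
  by apply: (eX v) => //; rewrite -ball_normE.
pose G := [set p : V * R | exists v a, v \in X /\ p = (v + a *: w, a)].
have [||||Phi [PhiE _]] := @hahn_banach R V e^-1 G _.
- by rewrite invr_ge0 ltW.
- by exists 0, 0; rewrite rpred0 scale0r addr0.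
- move=> a _ _ _ _ [v [b [vX [-> ->]]]] [v' [b' [v'X [-> ->]]]].
  exists (a *: v + v'), (a * b + b'); rewrite rpredD ?rpredZ//; split=> //.
  by rewrite scalerDr scalerDl scalerA addrACA.
- move=> _ _ [v [a [vX [-> ->]]]].
  rewrite mulrC ler_pdivlMr//.
  have [->|a0] := eqVneq a 0; first by rewrite mul0r.
  apply: (@le_trans _ _ (`|a| * e)); first by rewrite ler_pM2r// ler_norm.
  have : e <= `|w - - (a^-1 *: v)| by apply: eX; rewrite -scaleNr rpredZ.
  rewrite opprK => /(ler_wpM2l (normr_ge0 a)) /le_trans; apply.
  by rewrite -normrZ scalerDr scalerA mulfV// scale1r addrC.
exists Phi.
  by move=> v vX; apply: PhiE; exists v, 0; rewrite scale0r addr0.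
by apply: PhiE; exists 0, 1; rewrite rpred0 scale1r add0r.
Qed.

(** A vector of norm strictly between 0 and 1 is a convex combination of 0 and
    its normalization, and 0 is the midpoint of any two opposite vectors. *)
Lemma extreme_point_unit_ball v : extreme_point (unit_ball V) v ->
  (forall w, w = 0) \/ `|v| = 1.
Proof.
move=> [v1 vext]; have [v0|v0] := eqVneq v 0.
  left=> w; have [->//|w0] := eqVneq w 0.
  have e1 : `| `|w|^-1 *: w| <= 1.
    by rewrite normrZ normfV normr_id mulVf ?normr_eq0.
  have [|||||wv _] := vext (`|w|^-1 *: w) (- (`|w|^-1 *: w)) 2^-1.
  - exact: e1.
  - by rewrite /unit_ball/= normrN.
  - by rewrite invr_gt0.
  - lra.
  - by rewrite v0 -[1 - 2^-1](_ : 2^-1 = _) ?scalerN ?subrr//; lra.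
  move: wv => /eqP.
  by rewrite v0 scaler_eq0 invr_eq0 normr_eq0 (negPf w0) => /eqP.
right; apply/eqP; rewrite eq_le v1 leNgt /=; apply/negP => vlt1.
have [|||||_ v0E] := vext (`|v|^-1 *: v) 0 `|v|.
- by rewrite /unit_ball/= normrZ normfV normr_id mulVf ?normr_eq0.
- by rewrite /unit_ball/= normr0.
- by rewrite normr_gt0.
- exact: vlt1.
- by rewrite scalerA mulfV ?normr_eq0// scale1r scaler0 addr0.
by move: v0; rewrite -v0E eqxx.
Qed.

End duality.

Section subspace_duality.
Context (R : realType) (V : normedModType R) (X : submodClosed V).
Implicit Types (Phi : dual V) (phi : dual (subspace_of X)).

(** The transpose of the inclusion of [X]; its value is picked among the
    functionals with the right graph, of which [restrictionP] gives one. *)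
Definition restriction Phi : dual (subspace_of X) :=
  xget 0 [set phi : dual (subspace_of X) | forall u, phi u = Phi (val u)].

Lemma restrictionP Phi :
  (forall u, restriction Phi u = Phi (val u)) /\ `|restriction Phi| <= `|Phi|.
Proof.
have [phi phiE phi_le] : exists2 phi : dual (subspace_of X),
    (forall u, phi u = Phi (val u)) & `|phi| <= `|Phi|.
  apply: (@bounded_linear_dual R (subspace_of X)
    (fun u => Phi (val u) : R^o)) => //.
    by move=> a u v; rewrite -(dual_linear Phi); congr (Phi _); rewrite linearP.
  by move=> u; exact: (op_normP Phi (val u)).
have rE u : restriction Phi u = Phi (val u).
  by rewrite /restriction; case: xgetP => [? -> /=|/(_ phi)]; [exact|case].
split=> //; suff -> : restriction Phi = phi by [].
by apply: dual_ext => u; rewrite rE phiE.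
Qed.

Lemma restrictionE Phi u : restriction Phi u = Phi (val u).
Proof. exact: (restrictionP Phi).1. Qed.

Lemma restriction_surj phi : exists Phi, restriction Phi = phi.
Proof.
pose G := [set p : V * R | exists u : subspace_of X, p = (val u, phi u)].
have [||||Phi [PhiE _]] := @hahn_banach R V `|phi| G _.
- exact: normr_ge0.
- by exists 0; rewrite !raddf0.
- move=> a _ _ _ _ [u [-> ->]] [v [-> ->]]; exists (a *: u + v).
  by rewrite !linearP.
- move=> _ _ [u [-> ->]]; rewrite (le_trans (ler_norm _))//.
  exact: (op_normP phi u).
exists Phi; apply: dual_ext => u.
by rewrite restrictionE; apply: PhiE; exists u.
Qed.

(** The bitranspose of the inclusion of [X], applied to [y]. *)
Lemma bidual_push (y : bidual (subspace_of X)) : exists2 Y : bidual V,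
  (forall Phi, Y Phi = y (restriction Phi)) & `|Y| <= `|y|.
Proof.
apply: (@bounded_linear_dual R (dual V)
  (fun Phi => y (restriction Phi) : R^o)) => //.
  move=> a Phi Psi; rewrite -(dual_linear y); congr (y _); apply: dual_ext => u.
  rewrite restrictionE.
  rewrite -[RHS]/(a *: (restriction Phi u) + restriction Psi u).
  by rewrite !restrictionE.
move=> Phi; rewrite (le_trans (op_normP y _))// ler_wpM2l ?op_norm_ge0//.
by have [] := restrictionP Phi.
Qed.

(** By separation, [w] lies in [X]; by extension, the functionals on [X] are the
    restrictions on which [y] is known. *)
Lemma bidual_in_subspace (y : bidual (subspace_of X)) (w : V) :
  closed [set` X] -> (forall Phi, y (restriction Phi) = Phi w) ->
  exists u, y = to_bidual u.
Proof.
move=> cX yw.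
have wX : w \in X.
  apply: contrapT => /negP wX.
  have [Phi PhiX Phiw] := separating_functional cX wX.
  have : restriction Phi = 0.
    by apply: dual_ext => -[u uX]; rewrite restrictionE /= PhiX.
  move=> Phi0; have := yw Phi; rewrite Phi0 raddf0 Phiw => /eqP.
  by rewrite eq_sym oner_eq0.
exists (SubspaceOf wX); apply: dual_ext => phi.
have [Phi <-] := restriction_surj phi.
by rewrite yw -[RHS]/(restriction Phi _) restrictionE.
Qed.

End subspace_duality.

(** * L1 as a module over the bounded measurable functions *)

Lemma filterS4 (I : Type) (F : set_system I) {FF : Filter F}
    (P Q S U V : set I) :
  (forall i, P i -> Q i -> S i -> U i -> V i) ->
  F P -> F Q -> F S -> F U -> F V.
Proof.
move=> h FP FQ FS; apply: filterS3 FP (filterI FQ FS) => i Pi [Qi Si].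
exact: h.
Qed.

Lemma filterS5 (I : Type) (F : set_system I) {FF : Filter F}
    (P Q S U V W : set I) :
  (forall i, P i -> Q i -> S i -> U i -> V i -> W i) ->
  F P -> F Q -> F S -> F U -> F V -> F W.
Proof.
move=> h FP FQ FS; apply: filterS4 FP (filterI FQ FS) => i Pi [Qi Si].
exact: h.
Qed.

Section L1_functions.
Context d (T : measurableType d) (R : realType).
Variable mu : {measure set T -> \bar R}.
Implicit Types (u v : L1 mu) (f g h k : T -> R).

Lemma ae_eq_Rintegral f g : measurable_fun setT f -> measurable_fun setT g ->
  f = g %[ae mu] -> \int[mu]_t f t = \int[mu]_t g t.
Proof.
move=> mf mg fg; rewrite /Rintegral; congr fine; apply: ae_eq_integral => //.
- exact/measurable_EFinP.
- exact/measurable_EFinP.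
- by apply: filterS fg => t /[apply] ->.
Qed.

Lemma L1_measurable u : measurable_fun setT (L1_to_fun u).
Proof. exact: (@measurable_funPT _ _ _ _ (L1_rep u)). Qed.
Hint Resolve L1_measurable : core.

Lemma L1_integrable u : mu.-integrable setT (EFin \o L1_to_fun u).
Proof. by apply/Lfun1_integrable; exact: L1_to_fun_in. Qed.
Hint Resolve L1_integrable : core.

Definition L1_of f : L1 mu :=
  if pselect (f \in Lfun mu 1) is left fL then L1_class (Lfun_Sub (lexx _) fL)
  else 0.

Lemma L1_ofE f : mu.-integrable setT (EFin \o f) ->
  L1_to_fun (L1_of f) = f %[ae mu].
Proof.
move=> /Lfun1_integrable fL; rewrite /L1_of; case: pselect => // fL'.
exact: L1_classK.
Qed.

Lemma L1_ae_eq u v : L1_to_fun u = L1_to_fun v %[ae mu] -> u = v.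
Proof. by move=> uv; rewrite -(L1_repK u) -(L1_repK v); exact/L1_classP. Qed.

Lemma L1_linE a u v : L1_to_fun (a *: u + v) =
  (fun t => a * L1_to_fun u t + L1_to_fun v t) %[ae mu].
Proof.
have := L1_classK (a *: L1_rep u + L1_rep v).
by rewrite -L1_classD -L1_classZ !L1_repK.
Qed.

Lemma L1_normE u : `|u| = \int[mu]_t `|L1_to_fun u t|.
Proof. by rewrite [LHS]/(L1_norm u) /L1_norm Lnorm1. Qed.

Definition L1_int u := \int[mu]_t L1_to_fun u t.

Lemma L1_int_lin a u v : L1_int (a *: u + v) = a * L1_int u + L1_int v.
Proof.
rewrite /L1_int.
rewrite (ae_eq_Rintegral _ _ (L1_linE a u v))//; last first.
  by apply: measurable_funD => //; exact: measurable_funM.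
have iu : mu.-integrable setT (EFin \o (fun t => a * L1_to_fun u t)).
  exact: (integrableZl measurableT a (L1_integrable u)).
by rewrite RintegralD// RintegralZl.
Qed.

Lemma L1_int_norm u : `|L1_int u| <= `|u|.
Proof. by rewrite L1_normE; exact: le_normr_Rintegral. Qed.

(** Bounded measurable functions stay plain functions, with an explicit bound in
    the role of the sup norm. *)
Definition bounded_by (C : R) h :=
  measurable_fun setT h /\ forall t, `|h t| <= C.

Lemma bounded_by_cst a : bounded_by `|a| (cst a).
Proof. by split. Qed.

Lemma bounded_by_lin a h k C D : bounded_by C h -> bounded_by D k ->
  bounded_by (`|a| * C + D) (fun t => a * h t + k t).
Proof.
move=> [mh hC] [mk kD]; split.
  by apply: measurable_funD => //; exact: measurable_funM.
move=> t; rewrite (le_trans (ler_normD _ _))// lerD// normrM.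
by rewrite ler_wpM2l.
Qed.

Lemma bounded_byM h k C D : bounded_by C h -> bounded_by D k ->
  bounded_by (C * D) (h \* k).
Proof.
move=> [mh hC] [mk kD]; split; first exact: measurable_funM.
by move=> t; rewrite normrM ler_pM.
Qed.

Lemma bounded_by_indic (A : set T) : measurable A ->
  bounded_by 1 (\1_A : T -> R).
Proof.
move=> mA; split; first exact: measurable_indic.
by move=> t; rewrite indicE; case: (t \in A); rewrite ?normr1 ?normr0.
Qed.

Lemma bounded_by_sg u : bounded_by 1 (fun t => Num.sg (L1_to_fun u t)).
Proof.
split; last by move=> t; rewrite normr_sg; case: (_ != 0).
apply: measurable_fun_ifT => //=; first exact: measurable_fun_eqr.
by apply: measurable_fun_ifT => //=; exact: measurable_fun_ltr.
Qed.

Lemma integrable_bounded_mul C h f : bounded_by C h ->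
  mu.-integrable setT (EFin \o f) -> mu.-integrable setT (EFin \o (h \* f)).
Proof.
move=> [mh hC] fi.
apply: (@integrableMr _ _ _ mu setT measurableT h (EFin \o f)) => //.
exists C; split; first exact: num_real.
by move=> x Cx t _ /=; rewrite (le_trans (hC t))// ltW.
Qed.

Definition L1_mul h u := L1_of (h \* L1_to_fun u).

Lemma L1_mulE C h u : bounded_by C h ->
  L1_to_fun (L1_mul h u) = h \* L1_to_fun u %[ae mu].
Proof. by move=> hC; apply: L1_ofE; exact: integrable_bounded_mul hC _. Qed.

Lemma L1_mul_linr C h a u v : bounded_by C h ->
  L1_mul h (a *: u + v) = a *: L1_mul h u + L1_mul h v.
Proof.
move=> hC; apply: L1_ae_eq.
move: (L1_linE a u v) (L1_linE a (L1_mul h u) (L1_mul h v)) (L1_mulE u hC)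
  (L1_mulE v hC) (L1_mulE (a *: u + v) hC).
apply: filterS5 => t /(_ I) E /(_ I) -> /(_ I) Eu /(_ I) Ev /(_ I) -> _.
by rewrite /= Eu Ev E /=; ring.
Qed.

Lemma L1_mul_linl C D h k a u : bounded_by C h -> bounded_by D k ->
  L1_mul (fun t => a * h t + k t) u = a *: L1_mul h u + L1_mul k u.
Proof.
move=> hC kD; apply: L1_ae_eq.
move: (L1_mulE u hC) (L1_mulE u kD) (L1_linE a (L1_mul h u) (L1_mul k u))
  (L1_mulE u (bounded_by_lin a hC kD)).
apply: filterS4 => t /(_ I) Eu /(_ I) Ev /(_ I) -> /(_ I) -> _.
by rewrite /= Eu Ev /=; ring.
Qed.

Lemma L1_mul_mul C D h k u : bounded_by C h -> bounded_by D k ->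
  L1_mul h (L1_mul k u) = L1_mul (h \* k) u.
Proof.
move=> hC kD; apply: L1_ae_eq.
move: (L1_mulE (L1_mul k u) hC) (L1_mulE u kD) (L1_mulE u (bounded_byM hC kD)).
by apply: filterS3 => t /(_ I) -> /(_ I) E /(_ I) -> _; rewrite /= E /= mulrA.
Qed.

Lemma L1_mul1 u : L1_mul (cst 1) u = u.
Proof.
apply: L1_ae_eq; move: (L1_mulE u (bounded_by_cst 1)).
by apply: filterS => t /(_ I) -> _; rewrite /= mul1r.
Qed.

Lemma L1_norm_mul C h u : bounded_by C h ->
  `|L1_mul h u| = \int[mu]_t (`|h t| * `|L1_to_fun u t|).
Proof.
move=> hC; have [mh _] := hC; rewrite L1_normE; apply: ae_eq_Rintegral.
- exact: measurableT_comp.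
- by apply: measurable_funM; exact: measurableT_comp.
- by move: (L1_mulE u hC); apply: filterS => t /(_ I) -> _; rewrite normrM.
Qed.

Lemma integrable_norm_mul C h u : bounded_by C h ->
  mu.-integrable setT (EFin \o (fun t => `|h t| * `|L1_to_fun u t|)).
Proof.
move=> hC.
have := integrable_norm (integrable_bounded_mul hC (L1_integrable u)).
by apply: eq_integrable => //= t _; rewrite normrM.
Qed.

Lemma L1_norm_mul_le C D h k u : bounded_by C h -> bounded_by D k ->
  (forall t, `|h t| <= `|k t|) -> `|L1_mul h u| <= `|L1_mul k u|.
Proof.
move=> hC kD hk; rewrite (L1_norm_mul _ hC) (L1_norm_mul _ kD).
apply: le_Rintegral => //; first exact: integrable_norm_mul hC.
  exact: integrable_norm_mul kD.
by move=> t _; rewrite ler_wpM2r.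
Qed.

Lemma L1_norm_mul_bound C h u : bounded_by C h -> `|L1_mul h u| <= C * `|u|.
Proof.
move=> hC; have [mh hC'] := hC; rewrite (L1_norm_mul _ hC) L1_normE.
have iu : mu.-integrable setT (EFin \o (fun t => `|L1_to_fun u t|)).
  exact: integrable_norm.
rewrite -RintegralZl//; apply: le_Rintegral => //.
- exact: integrable_norm_mul hC.
- exact: (integrableZl measurableT C iu).
- by move=> t _; rewrite ler_wpM2r.
Qed.

Lemma L1_int_sg_mul C h u : bounded_by C h ->
  L1_int (L1_mul (fun t => Num.sg (L1_to_fun u t) * `|h t|) u) = `|L1_mul h u|.
Proof.
move=> hC; have [mh _] := hC; rewrite (L1_norm_mul _ hC).
have hC' : bounded_by C (fun t => `|h t|).
  by split; [exact: measurableT_comp|move=> t; rewrite normr_id; case: hC].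
apply: ae_eq_Rintegral => //.
  by apply: measurable_funM; exact: measurableT_comp.
move: (L1_mulE u (bounded_byM (bounded_by_sg u) hC')).
by apply: filterS => t /(_ I) -> _ /=; rewrite (normrEsg (L1_to_fun u t)); ring.
Qed.

Lemma L1_int_sg u : L1_int (L1_mul (fun t => Num.sg (L1_to_fun u t)) u) = `|u|.
Proof.
have -> : (fun t => Num.sg (L1_to_fun u t)) =
    (fun t => Num.sg (L1_to_fun u t) * `|(cst 1 : T -> R) t|).
  by apply/funext => t; rewrite normr1 mulr1.
by rewrite (L1_int_sg_mul u (bounded_by_cst 1)) L1_mul1.
Qed.

End L1_functions.
#[export] Hint Resolve L1_measurable L1_integrable : core.

(** * Radon-Nikodym derivatives on a sigma-finite part *)

Section radon_nikodym_restriction.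
Context d (T : measurableType d) (R : realType).
Variable mu : {measure set T -> \bar R}.
Context (S : set T) (mS : measurable S).
Local Open Scope ereal_scope.

Lemma integral_mrestr (D : set T) (f : T -> \bar R) : measurable D ->
  measurable_fun D f ->
  \int[mrestr mu mS]_(t in D) f t = \int[mu]_(t in D `&` S) f t.
Proof.
move=> mD mf; rewrite -{1}(setUIDK D S) integral_setU//; last 4 first.
- exact: measurableI.
- exact: measurableD.
- by rewrite setUIDK.
- by apply/disj_setPS => t [[_ St] [_ /(_ St)]].
rewrite (null_set_integral (measurableD mD mS)); last 2 first.
- by apply: measurable_funS mf => //; exact: subDsetl.
- change (mu ((D `\` S) `&` S) = 0).
  by rewrite (_ : _ `&` _ = set0) ?measure0// setDE -setIA setICl setI0.
rewrite adde0; apply: eq_measure_integral => A mA; rewrite subsetI => -[_ AS].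
by rewrite /= /mrestr (setIidl AS).
Qed.

(** [mu] itself may fail to be sigma-finite: only its trace on [S] has to be,
    and the density is extended by 0 outside [S]. *)
Lemma radon_nikodym_mrestr (lam : {charge set T -> \bar R}) :
  sigma_finite setT (mrestr mu mS) ->
  (forall A, measurable A -> mu (A `&` S) = 0 -> lam A = 0) ->
  exists2 r : T -> R, mu.-integrable setT (EFin \o r) &
    forall A, measurable A -> lam A = \int[mu]_(t in A) (r t)%:E.
Proof.
move=> sf ac.
pose nu : {sigma_finite_measure set T -> \bar R} :=
  HB.pack (mrestr mu mS) (Measure_isSigmaFinite.Build _ _ _ (mrestr mu mS) sf).
have lamnu : lam `<< nu by apply/null_content_dominatesP => A mA; exact: ac.
pose f := Radon_Nikodym lam nu.
have ffin t : f t \is a fin_num by exact: Radon_Nikodym_fin_num.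
have fi : nu.-integrable setT f by exact: Radon_Nikodym_integrable.
have mf := measurable_int _ fi.
have fE A : measurable A -> lam A = \int[mu]_(t in A) (f \_ S) t.
  move=> mA; rewrite (Radon_Nikodym_integral lamnu)// integral_mrestr//.
    by rewrite -integral_mkcondr.
  exact: measurable_funS mf.
have fiS : mu.-integrable setT (f \_ S).
  apply/(integrable_mkcond _ mS)/integrableP; split.
    exact: measurable_funS mf.
  move/integrableP : fi => [_]; rewrite integral_mrestr// ?setTI//.
  exact: measurableT_comp.
have fS : f \_ S = EFin \o (fine \o (f \_ S)).
  by apply/funext => t /=; rewrite fineK// patchE; case: ifP.
by exists (fine \o (f \_ S)) => [|A mA]; [rewrite -fS|rewrite fE// fS].
Qed.

End radon_nikodym_restriction.

(** * Functionals on bounded functions vanishing on indicators *)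

Section bounded_representation.
Context d (T : measurableType d) (R : realType).
Variable mu : {measure set T -> \bar R}.
Implicit Types (u : L1 mu) (h k : T -> R).

Definition bounded_linear_on (L : (T -> R) -> R) := forall a h k C D,
  bounded_by C h -> bounded_by D k ->
  L (fun t => a * h t + k t) = a * L h + L k.

Lemma pow2_archimedean (a b : R) : 0 <= a ->
  (forall n, a * 2 ^+ n <= b) -> a = 0.
Proof.
move=> a0 ab; apply/eqP; rewrite eq_le a0 andbT leNgt; apply/negP => agt0.
have := ab (Num.bound (b / a)); apply/negP; rewrite -ltNge.
have b0 : 0 <= b by apply: le_trans (ab 0%N); rewrite expr0 mulr1.
rewrite mulrC -ltr_pdivrMr//.
have := archi_boundP (divr_ge0 b0 a0) => /lt_trans; apply.
by rewrite -natrX ltr_nat ltn_expl.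
Qed.

(** For [h] between 0 and [M], subtracting [M / 2] times the indicator of the
    set where [M / 2 <= h] leaves a function between 0 and [M / 2], without
    changing the value of [L]. Iterating this replaces the uniform approximation
    of [h] by simple functions. *)
Lemma halving_bound (L : (T -> R) -> R) (K : R) : bounded_linear_on L ->
  (forall C h, bounded_by C h -> `|L h| <= K * C) ->
  (forall A, measurable A -> L \1_A = 0) ->
  forall n M h, measurable_fun setT h -> (forall t, 0 <= h t <= M) ->
  `|L h| * 2 ^+ n <= K * M.
Proof.
move=> Llin LK L0; elim=> [|n IHn] M h mh hM.
  rewrite expr0 mulr1; apply: LK; split => // t.
  by have /andP[h0 hM'] := hM t; rewrite ger0_norm.
pose A := [set t | M / 2 <= h t].
have mA : measurable A.
  by rewrite -[A]setTI; exact: measurable_fun_le.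
have h'P t : 0 <= h t - M / 2 * \1_A t <= M / 2.
  have /andP[h0 hM'] := hM t; rewrite indicE /=.
  case: (boolP (t \in A)); rewrite ?notin_setE ?in_setE /A /= => At; first lra.
  by move/negP : At; rewrite -ltNge; lra.
pose h' := fun t => h t - M / 2 * \1_A t.
have mh' : measurable_fun setT h'.
  by apply: measurable_funB => //; exact: measurable_funM.
have h'b : bounded_by (M / 2) h'.
  by split => // t; have /andP[h0 h1] := h'P t; rewrite ger0_norm.
have -> : L h = L h'.
  have -> : h = (fun t => M / 2 * \1_A t + h' t).
    by apply/funext => t; rewrite /h'; ring.
  by rewrite (Llin _ _ _ _ _ (bounded_by_indic R mA) h'b) L0// mulr0 add0r.
by have := IHn _ _ mh' h'P; rewrite exprS; lra.
Qed.

Lemma vanish_on_bounded (L : (T -> R) -> R) (K : R) : bounded_linear_on L ->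
  (forall C h, bounded_by C h -> `|L h| <= K * C) ->
  (forall A, measurable A -> L \1_A = 0) ->
  forall C h, bounded_by C h -> L h = 0.
Proof.
move=> Llin LK L0 C h hC; have [mh hC'] := hC.
(* Adding the constant [C] makes [h] nonnegative. *)
have bC : bounded_by 1 (\1_setT : T -> R) by exact: bounded_by_indic.
have shift : L (fun t => C * \1_setT t + h t) = L h.
  by rewrite (Llin _ _ _ _ _ bC hC) L0// mulr0 add0r.
apply/normr0_eq0; rewrite -shift.
apply: (@pow2_archimedean _ (K * (2 * C))) => // n.
apply: halving_bound => //.
  by apply: measurable_funD => //; exact: measurable_funM.
move=> t; rewrite indicT /= mulr1.
by have := hC' t; rewrite ler_norml => /andP[]; lra.
Qed.

Lemma ae_le0 (q : T -> R) : mu.-integrable setT (EFin \o q) ->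
  (forall A, measurable A -> (\int[mu]_(t in A) (q t)%:E <= 0)%E) ->
  {ae mu, forall t, q t <= 0}.
Proof.
move=> qi q0; pose B := [set t | 0 < q t].
have mq : measurable_fun setT q.
  by apply/measurable_EFinP; case/integrableP : qi.
have mB : measurable B by rewrite -[B]setTI; exact: measurable_fun_ltr.
have int0 : (\int[mu]_(t in B) `|(q t)%:E| = 0)%E.
  apply/eqP; rewrite eq_le integral_ge0// andbT.
  rewrite (le_trans _ (q0 B mB))//.
  rewrite (@eq_integral _ _ _ mu B (fun t => (q t)%:E))// => t /[!in_setE] Bt.
  by rewrite gee0_abs// lee_fin ltW.
have mqB : measurable_fun B (EFin \o q).
  by apply: (measurable_funS measurableT) => //; exact/measurable_EFinP.
have /(_ int0) := (ae_eq_integral_abs mu mB mqB).1.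
apply: filterS => t /= qt; rewrite leNgt; apply/negP => Bt.
by have [q0t] := qt Bt; move: Bt; rewrite q0t ltxx.
Qed.

Lemma ae_norm_le (r p : T -> R) : mu.-integrable setT (EFin \o r) ->
  mu.-integrable setT (EFin \o p) ->
  (forall A, measurable A ->
    (`|\int[mu]_(t in A) (r t)%:E| <= \int[mu]_(t in A) (p t)%:E)%E) ->
  {ae mu, forall t, `|r t| <= p t}.
Proof.
move=> ri pi rp.
have riA A : measurable A -> mu.-integrable A (EFin \o r).
  by move=> mA; apply: integrableS ri.
have piA A : measurable A -> mu.-integrable A (EFin \o p).
  by move=> mA; apply: integrableS pi.
have up : {ae mu, forall t, r t - p t <= 0}.
  apply: ae_le0 => [|A mA]; first exact: (integrableB measurableT ri pi).
  rewrite integralB_EFin//; last 2 first.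
  - exact: riA.
  - exact: piA.
  rewrite sube_le0 (le_trans _ (rp A mA))//; exact: lee_abs.
have lo : {ae mu, forall t, - r t - p t <= 0}.
  apply: ae_le0 => [|A mA].
    exact: (integrableB measurableT (integrableN ri) pi).
  rewrite integralB_EFin//; last 2 first.
  - exact: integrableN (riA A mA).
  - exact: piA.
  rewrite sube_le0 (le_trans _ (rp A mA))// -abseN -integralN; last first.
    exact/integrable_add_def/riA.
  exact: lee_abs.
by move: up lo; apply: filterS2 => t; rewrite ler_norml; lra.
Qed.

Lemma L1_norm_indic u (A : set T) : measurable A ->
  (`|L1_mul \1_A u|%:E = \int[mu]_(t in A) `|L1_to_fun u t|%:E)%E.
Proof.
move=> mA; rewrite (L1_norm_mul u (bounded_by_indic R mA)) fineK; last first.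
  apply: integrable_fin_num => //.
  exact: (integrable_norm_mul u (bounded_by_indic R mA)).
rewrite [RHS]integral_mkcond; apply: eq_integral => t _.
rewrite patchE indicE.
by case: (t \in A); rewrite ?normr1 ?normr0 ?mul1r ?mul0r.
Qed.

(** Dominated convergence, with [|u|] as the dominating function. *)
Lemma L1_norm_indic_cvg0 u (A : (set T)^nat) : (forall n, measurable (A n)) ->
  (forall t, exists N, forall n, (N <= n)%N -> ~ A n t) ->
  `|L1_mul \1_(A n) u| @[n --> \oo] --> 0.
Proof.
move=> mA A0; have bA n := bounded_by_indic R (mA n).
rewrite (_ : (fun n => _) = fine \o (fun n =>
    \int[mu]_t (`|\1_(A n) t| * `|L1_to_fun u t|)%:E)%E); last first.
  by apply/funext => n; rewrite (L1_norm_mul u (bA n)).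
apply: fine_cvg.
rewrite (_ : 0%:E = \int[mu]_t (cst 0 t))%E; last by rewrite integral0.
have iu : mu.-integrable setT (EFin \o (fun t => `|L1_to_fun u t|)).
  exact: integrable_norm.
apply: (dominated_cvg measurableT _ _ _ iu) => //.
- by move=> n; exact: (measurable_int mu (integrable_norm_mul u (bA n))).
- move=> t _; apply: cvg_near_cst; have [N AN] := A0 t.
  exists N => // n /= Nn; rewrite indicE memNset ?normr0 ?mul0r//; exact: AN.
- move=> n t _ /=; rewrite lee_fin normrM !normr_id.
  by rewrite ler_piMl//; case: (bA n).
Qed.

End bounded_representation.

(** * Functionals dominated by an L1 function *)

Lemma measurable_invr (R : realType) : measurable_fun setT (fun y : R => y^-1).
Proof.
have -> : (fun y : R => y^-1) = (fun y => y * (`|y| `^ (-1)) ^+ 2).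
  apply/funext => y; rewrite powR_inv1// exprVn real_normK ?num_real//.
  by have [->|y0] := eqVneq y 0; [rewrite invr0 mul0r|field].
apply: measurable_funM => //; apply: measurable_funX.
exact: (measurableT_comp (measurable_powR _)).
Qed.

Section truncated_quotient.
Context d (T : measurableType d) (R : realType).
Implicit Types f g : T -> R.

(** The truncation makes the quotient bounded everywhere, while an inequality
    [|f| <= C |g|] is usually known only almost everywhere. *)
Definition truncated_quotient (C : R) f g t :=
  if `|f t| <= C * `|g t| then f t / g t else 0.

Lemma bounded_by_truncated_quotient C f g : 0 <= C ->
  measurable_fun setT f -> measurable_fun setT g ->
  bounded_by C (truncated_quotient C f g).
Proof.
move=> C0 mf mg; split.
  apply: measurable_fun_ifT => //=.
    apply: measurable_fun_ler; first exact: measurableT_comp.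
    by apply: measurable_funM => //; exact: measurableT_comp.
  apply: measurable_funM => //.
  exact: (measurableT_comp (@measurable_invr R) mg).
move=> t; rewrite /truncated_quotient.
case: ifP => [ft|_]; last by rewrite normr0.
have [gt|gt] := eqVneq (g t) 0; first by rewrite gt invr0 mulr0 normr0.
by rewrite normrM normfV ler_pdivrMr ?normr_gt0.
Qed.

End truncated_quotient.

Section bounded_density.
Context d (T : measurableType d) (R : realType).
Variable mu : {measure set T -> \bar R}.
Implicit Types (u : L1 mu) (h : T -> R).

Lemma L1_measurable_support u : measurable [set t | L1_to_fun u t != 0].
Proof.
rewrite (_ : [set t | _] = ~` (L1_to_fun u @^-1` [set 0])).
  apply: measurableC; rewrite -[X in measurable X]setTI.
  exact: (L1_measurable u).
by apply/seteqP; split => t /= /eqP.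
Qed.

(** The sets where [|u| >= 1 / (n + 1)] have finite measure by Markov's
    inequality, and they cover the support of [u]. *)
Lemma L1_sigma_finite_support u :
  sigma_finite setT (mrestr mu (L1_measurable_support u)).
Proof.
pose E n := [set t | (n.+1%:R^-1%:E <= `|(L1_to_fun u t)%:E|)%E].
have mu_u : measurable_fun setT (EFin \o L1_to_fun u) by exact/measurable_EFinP.
have mE n : measurable (E n).
  rewrite -[E n]setTI; apply: emeasurable_fun_c_infty => //.
  exact: measurableT_comp.
exists (fun n => ~` [set t | L1_to_fun u t != 0] `|` E n).
  apply/esym/seteqP; split => // t _.
  have [ut|ut] := eqVneq (L1_to_fun u t) 0.
    by exists 0%N => //; left; rewrite /= ut eqxx.
  exists (Num.bound `|L1_to_fun u t|^-1) => //; right.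
  rewrite /E /= lee_fin invf_ple ?posrE ?normr_gt0//.
  have ge0 : 0 <= `|L1_to_fun u t|^-1 by rewrite invr_ge0.
  by rewrite (le_trans (ltW (archi_boundP ge0)))// ler_nat.
move=> n; split.
  by apply: measurableU => //; exact/measurableC/L1_measurable_support.
have n0 : 0 < n.+1%:R^-1 :> R by rewrite invr_gt0.
have muE : (n.+1%:R^-1%:E * mu (E n) <= \int[mu]_t `|(L1_to_fun u t)%:E|)%E.
  have := @le_integral_comp_abse _ _ _ mu setT measurableT _ _ id _ _ _ mu_u n0.
  by rewrite setTI; apply.
have [_ ulty] := integrableP _ _ _ (L1_integrable u).
rewrite /mrestr setIUl setICl set0U.
have mES : measurable (E n `&` [set t | L1_to_fun u t != 0]).
  by apply: measurableI => //; exact: L1_measurable_support.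
apply: (@le_lt_trans _ _ (mu (E n))); first by apply: le_measure; rewrite ?inE.
rewrite ltey; apply/negP => /eqP muEy.
move: (le_lt_trans muE ulty).
by rewrite -/(E n) muEy gt0_muley ?lte_fin// ltxx.
Qed.

Context (x : L1 mu) (L : (T -> R) -> R) (C : R).
Hypotheses (C0 : 0 <= C) (Llin : bounded_linear_on L)
  (Lx : forall D h, bounded_by D h -> `|L h| <= C * `|L1_mul h x|).

Let lam (A : set T) : \bar R := (L \1_A)%:E.

Lemma functional_indicU (A B : set T) : measurable A -> measurable B ->
  A `&` B = set0 -> L \1_(A `|` B) = L \1_A + L \1_B.
Proof.
move=> mA mB AB0; rewrite -[L \1_A]mul1r.
rewrite -(Llin 1 (bounded_by_indic R mA) (bounded_by_indic R mB)); congr L.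
apply/funext => t; rewrite !indicE in_setU mul1r.
have : ~ (A t /\ B t) by move=> [At Bt]; rewrite -[False]/(set0 t) -AB0.
by case: (boolP (t \in A)); case: (boolP (t \in B)); rewrite ?inE//=;
  rewrite ?addr0 ?add0r// => Bt At; case.
Qed.

(** The remainder is the value of [L] at the indicator of the union of the
    [F i], [n <= i], and it is dominated by the integral of [C |x|] there. *)
Lemma functional_indic_sigma_additive : semi_sigma_additive lam.
Proof.
move=> F mF tF mUF.
pose rest n := \bigcup_(i in [set i | (n <= i)%N]) F i.
have mrest n : measurable (rest n) by exact: bigcup_measurable.
have restS n : rest n = F n `|` rest n.+1.
  apply/seteqP; split => [t [i /= ni Fit]|t [Ft|[i /= ni Fit]]].
  - move: ni; rewrite leq_eqVlt => /predU1P[->|ni]; first by left.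
    by right; exists i.
  - by exists n => /=.
  - by exists i => //=; exact: ltnW.
have disj n : F n `&` rest n.+1 = set0.
  rewrite -subset0 => t [Fnt [i /= ni Fit]].
  by move: ni; rewrite (tF n i I I) ?ltnn//; exists t.
have rest_sum n :
    L \1_(\bigcup_i F i) = \sum_(0 <= i < n) L \1_(F i) + L \1_(rest n).
  elim: n => [|n IHn].
    rewrite big_nil add0r; congr (L \1_ _).
    by apply/seteqP; split => t [i _ Fit]; exists i.
  by rewrite IHn big_nat_recr//= restS functional_indicU// addrA.
have -> : (fun n => \sum_(0 <= i < n) lam (F i))%E =
    EFin \o (fun n => L \1_(\bigcup_i F i) - L \1_(rest n)).
  by apply/funext => n /=; rewrite (rest_sum n) addrK sumEFin.
apply: cvg_EFin; first exact: nearW.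
rewrite -[X in _ --> X]subr0; apply: cvgB; first exact: cvg_cst.
have rest0 : C * `|L1_mul \1_(rest n) x| @[n --> \oo] --> 0.
  rewrite -(mulr0 C); apply: cvgM; first exact: cvg_cst.
  apply: L1_norm_indic_cvg0 => // t.
  have [[i Fit]|nF] := pselect (exists i, F i t).
    exists i.+1 => n ni [j /= nj Fjt].
    by move: (leq_trans ni nj); rewrite (tF i j I I) ?ltnn//; exists t.
  by exists 0%N => n _ [i _ Fit]; apply: nF; exists i.
apply: (squeeze_cvgr (f := fun n => - (C * `|L1_mul \1_(rest n) x|)));
  last 2 first.
- by rewrite -oppr0; exact: cvgN.
- exact: rest0.
apply: nearW => n; rewrite -ler_norml.
exact: (Lx (bounded_by_indic R (mrest n))).
Qed.

Lemma functional_radon_nikodym :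
  exists2 r : T -> R, mu.-integrable setT (EFin \o r) &
    forall A, measurable A -> lam A = (\int[mu]_(t in A) (r t)%:E)%E.
Proof.
have lam0 : lam set0 = 0%E.
  congr EFin; apply/normr0_eq0/eqP; rewrite eq_le normr_ge0 andbT.
  rewrite (le_trans (Lx (bounded_by_indic R measurable0)))//.
  by rewrite -lee_fin EFinM L1_norm_indic// integral_set0 mule0.
pose lamc : {charge set T -> \bar R} := HB.pack lam (isCharge.Build _ _ _ lam
  lam0 (fun _ _ => erefl) functional_indic_sigma_additive).
apply: (radon_nikodym_mrestr (lam := lamc) (L1_sigma_finite_support x)).
move=> A mA muAS; congr EFin; apply/normr0_eq0/eqP.
rewrite eq_le normr_ge0 andbT.
rewrite (le_trans (Lx (bounded_by_indic R mA)))//.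
suff : (`|L1_mul \1_A x|%:E = 0)%E by case=> ->; rewrite mulr0.
pose f t := `|L1_to_fun x t|%:E.
have fS : (\int[mu]_(t in A) f t =
    \int[mu]_(t in A `&` [set t | L1_to_fun x t != 0%R]) f t)%E.
  rewrite integral_mkcondr; apply: eq_integral => t _; rewrite patchE.
  case: ifPn => //; rewrite notin_setE /= => /negP; rewrite negbK => /eqP xt.
  by rewrite /f xt normr0.
rewrite L1_norm_indic// [LHS]fS; apply: null_set_integral => //.
  by apply: measurableI => //; exact: L1_measurable_support.
apply: (measurable_funS measurableT) => //.
exact: (measurable_int mu (integrable_norm (L1_integrable x))).
Qed.

(** The dual of [L1] of the finite measure with density [|x|] is [L_infinity],
    in a form that mentions neither that measure nor classes of bounded
    functions. The Radon-Nikodym density [r] of [L] satisfies [|r| <= C |x|]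
    almost everywhere, so that [r = g x] with [|g| <= C]. *)
Theorem bounded_density : exists2 g, bounded_by C g &
  forall D h, bounded_by D h -> L h = L1_int (L1_mul h (L1_mul g x)).
Proof.
have [r ri rE] := functional_radon_nikodym.
have mr : measurable_fun setT r.
  by apply/measurable_EFinP; case/integrableP : ri.
pose x_ := L1_to_fun x.
have mx : measurable_fun setT x_ := L1_measurable x.
have Cxi : mu.-integrable setT (EFin \o (fun t => C * `|x_ t|)).
  exact: (integrableZl measurableT C (integrable_norm (L1_integrable x))).
have rC : {ae mu, forall t, `|r t| <= C * `|x_ t|}.
  apply: ae_norm_le => // A mA; rewrite -rE//.
  under eq_integral do rewrite EFinM.
  rewrite integralZl//; last first.
    apply: (integrableS measurableT) => //.
    exact: (integrable_norm (L1_integrable x)).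
  rewrite -L1_norm_indic// -EFinM lee_fin.
  exact: (Lx (bounded_by_indic R mA)).
pose g := truncated_quotient C r x_.
have gC : bounded_by C g := bounded_by_truncated_quotient C0 mr mx.
have gx : L1_to_fun (L1_mul g x) = r %[ae mu].
  move: rC (L1_mulE x gC); apply: filterS2 => t rt /(_ I) -> _.
  rewrite /= /g /truncated_quotient rt.
  have [xt|xt] := eqVneq (x_ t) 0; last by rewrite mulfVK.
  by move: rt; rewrite -/(x_ t) xt normr0 mulr0 normr_le0 mulr0 => /eqP ->.
exists g => // D h hD; apply/eqP; rewrite -subr_eq0; apply/eqP.
pose M h := L h - L1_int (L1_mul h (L1_mul g x)).
apply: (@vanish_on_bounded _ _ _ M ((C + C) * `|x|) _ _ _ D h hD).
- move=> a k l Ck Cl kC lC; rewrite /M (Llin _ kC lC) (L1_mul_linl a _ kC lC).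
  by rewrite L1_int_lin; ring.
- move=> K k kK; rewrite (le_trans (ler_normB _ _))//.
  have K0 : `|L1_mul k x| <= K * `|x| := L1_norm_mul_bound x kK.
  rewrite mulrDl mulrDl lerD//.
    by rewrite (le_trans (Lx kK))// -mulrA ler_wpM2l// mulrC.
  rewrite (le_trans (L1_int_norm _))// (L1_mul_mul _ kK gC).
  have -> : k \* g = g \* k by apply/funext => t /=; rewrite mulrC.
  rewrite -(L1_mul_mul _ gC kK) (le_trans (L1_norm_mul_bound _ gC))//.
  by rewrite -mulrA ler_wpM2l// mulrC.
- move=> A mA; rewrite /M; apply/eqP; rewrite subr_eq0; apply/eqP.
  apply: EFin_inj; rewrite -/(lam A) rE// /L1_int fineK; last first.
    by apply: integrable_fin_num => //; exact: L1_integrable.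
  have rA : mu.-integrable setT ((EFin \o r) \_ A).
    by apply/(integrable_mkcond _ mA); apply: integrableS ri.
  rewrite integral_mkcond; apply: ae_eq_integral; first exact: measurableT.
  - exact: measurable_int rA.
  - exact: measurable_int (L1_integrable _).
  - move: gx (L1_mulE (L1_mul g x) (bounded_by_indic R mA)).
    apply: filterS2 => t /(_ I) gxt /(_ I) -> _ /=.
    by rewrite gxt patchE indicE; case: ifP; rewrite ?mul1r ?mul0r.
Qed.

End bounded_density.

(** * Functionals on L1 *)

Section pairing.
Context d (T : measurableType d) (R : realType).
Variable mu : {measure set T -> \bar R}.
Implicit Types (u f : L1 mu) (h k : T -> R) (Phi : dual (L1 mu)).

(** The functional [u |-> int h u], as a total function of [h] so that no proof
    of boundedness enters the terms; [pairingP] shows that the default value 0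
    is not taken when [h] is bounded. *)
Definition pairing h : dual (L1 mu) :=
  xget 0 [set phi : dual (L1 mu) | forall u, phi u = L1_int (L1_mul h u)].

Lemma pairingP C h : bounded_by C h ->
  (forall u, pairing h u = L1_int (L1_mul h u)) /\ `|pairing h| <= `|C|.
Proof.
move=> hC.
have [phi phiE phiC] : exists2 phi : dual (L1 mu),
    (forall u, phi u = L1_int (L1_mul h u)) & `|phi| <= `|C|.
  apply: (@bounded_linear_dual _ _ (fun u => L1_int (L1_mul h u) : R^o)) => //.
    by move=> a u v; rewrite (L1_mul_linr a u v hC) L1_int_lin.
  move=> u; rewrite (le_trans (L1_int_norm _))//.
  by rewrite (le_trans (L1_norm_mul_bound u hC))// ler_wpM2r// ler_norm.
have pE u : pairing h u = L1_int (L1_mul h u).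
  by rewrite /pairing; case: xgetP => [? -> /=|/(_ phi)]; [exact|case].
split=> //; suff -> : pairing h = phi by [].
by apply: dual_ext => u; rewrite pE phiE.
Qed.

Lemma pairingE C h u : bounded_by C h -> pairing h u = L1_int (L1_mul h u).
Proof. by move=> /pairingP[]. Qed.

Lemma norm_pairing (C : R) h : 0 <= C -> bounded_by C h -> `|pairing h| <= C.
Proof. by move=> C0 /pairingP[_]; rewrite (ger0_norm C0). Qed.

Lemma pairing_lin a h k C D : bounded_by C h -> bounded_by D k ->
  pairing (fun t => a * h t + k t) = a *: pairing h + pairing k.
Proof.
move=> hC kD; apply: dual_ext => u.
rewrite (pairingE u (bounded_by_lin a hC kD)).
rewrite (L1_mul_linl a u hC kD) L1_int_lin.
by rewrite -(pairingE u hC) -(pairingE u kD).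
Qed.

Lemma pairing0 : pairing (cst 0) = 0.
Proof.
have b0 := bounded_by_cst T (0 : R).
have -> : cst 0 = (fun t : T => -1 * cst 0 t + cst 0 t) :> (T -> R).
  by apply/funext => t /=; rewrite mulr0 addr0.
by rewrite (pairing_lin (-1) b0 b0) scaleN1r addNr.
Qed.

Lemma pairingN C k : bounded_by C k -> pairing (fun t => - k t) = - pairing k.
Proof.
move=> kC; have -> : (fun t => - k t) = (fun t => -1 * k t + cst 0 t).
  by apply/funext => t; rewrite mulN1r addr0.
rewrite (pairing_lin (-1) kC (bounded_by_cst T (0 : R))).
by rewrite pairing0 scaleN1r addr0.
Qed.

Lemma L1_norm_split u (A : set T) : measurable A ->
  `|u| = `|L1_mul \1_A u| + `|L1_mul \1_(~` A) u|.
Proof.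
move=> mA; have bA := bounded_by_indic R mA.
have bC := bounded_by_indic R (measurableC mA).
rewrite (L1_norm_mul u bA) (L1_norm_mul u bC) L1_normE.
rewrite -RintegralD//; last 2 first.
- exact: integrable_norm_mul bA.
- exact: integrable_norm_mul bC.
apply: eq_Rintegral => t _; rewrite -mulrDl !indicE in_setC.
by case: (t \in A); rewrite /= normr0 normr1 ?addr0 ?add0r mul1r.
Qed.

Lemma L1_mul_split u (A : set T) : measurable A ->
  u = L1_mul \1_A u + L1_mul \1_(~` A) u.
Proof.
move=> mA; have bA := bounded_by_indic R mA.
have bC := bounded_by_indic R (measurableC mA).
rewrite -[L1_mul \1_A u]scale1r -(L1_mul_linl 1 u bA bC) -[LHS]L1_mul1.
congr (L1_mul _ u); apply/funext => t; rewrite mul1r !indicE in_setC.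
by case: (t \in A); rewrite /= ?addr0 ?add0r.
Qed.

(** On the support of [x], the function [f] is the limit in norm of the products
    [k n * x], with [k n] the quotient [f / x] truncated at [n]. *)
Lemma dual_vanish_on_support Phi (x : L1 mu) f :
  (forall C k, bounded_by C k -> Phi (L1_mul k x) = 0) ->
  Phi (L1_mul \1_[set t | L1_to_fun x t != 0] f) = 0.
Proof.
move=> Phi0; set S := [set t | _].
have mS : measurable S := L1_measurable_support x.
have bS := bounded_by_indic R mS.
pose A n := S `&` [set t | n%:R * `|L1_to_fun x t| < `|L1_to_fun f t|].
have mf := L1_measurable f; have mx := L1_measurable x.
have mA n : measurable (A n).
  apply: measurableI => //; rewrite -[X in measurable X]setTI.
  apply: (measurable_fun_ltr _ _ measurableT (Y := [set true])) => //.
    by apply: measurable_funM => //; exact: measurableT_comp.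
  exact: measurableT_comp.
have bA n := bounded_by_indic R (mA n).
pose k n := truncated_quotient n%:R (L1_to_fun f) (L1_to_fun x).
have bk n : bounded_by n%:R (k n) by exact: bounded_by_truncated_quotient.
have fE n : L1_mul \1_S f = 1 *: L1_mul (k n) x + L1_mul \1_(A n) f.
  apply: L1_ae_eq.
  move: (L1_mulE f bS) (L1_mulE x (bk n)) (L1_mulE f (bA n))
    (L1_linE 1 (L1_mul (k n) x) (L1_mul \1_(A n) f)).
  apply: filterS4 => t /(_ I) -> /(_ I) E1 /(_ I) E2 /(_ I) -> _.
  rewrite E1 E2 /= mul1r /k /truncated_quotient !indicE /A in_setI.
  have -> : (t \in S) = (L1_to_fun x t != 0) by apply/idP/idP; rewrite inE.
  rewrite (_ : (t \in [set _ | _]) =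
      (n%:R * `|L1_to_fun x t| < `|L1_to_fun f t|)).
    have [ft|ft] := leP `|L1_to_fun f t| (n%:R * `|L1_to_fun x t|).
      have [xt|xt] := eqVneq (L1_to_fun x t) 0.
        move: ft; rewrite xt normr0 mulr0 normr_le0 => /eqP ->.
        by rewrite !mulr0 addr0.
      by rewrite /= mulfVK// !mul0r addr0 mul1r.
    by rewrite mul0r add0r andbT.
  by apply/idP/idP; rewrite inE.
apply/normr0_eq0/eqP; rewrite eq_le normr_ge0 andbT.
have lim0 : `|Phi| * `|L1_mul \1_(A n) f| @[n --> \oo] --> 0.
  rewrite -(mulr0 `|Phi|); apply: cvgM; first exact: cvg_cst.
  apply: L1_norm_indic_cvg0 => // t.
  have [xt|xt] := eqVneq (L1_to_fun x t) 0.
    by exists 0%N => n _ [/negP + _]; apply; apply/eqP.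
  exists (Num.bound (`|L1_to_fun f t| / `|L1_to_fun x t|)) => n nN [_ /=].
  apply/negP; rewrite -leNgt -ler_pdivrMr ?normr_gt0//.
  have ge0 : 0 <= `|L1_to_fun f t| / `|L1_to_fun x t| by rewrite divr_ge0.
  by rewrite (le_trans (ltW (archi_boundP ge0)))// ler_nat.
apply: (ler_cvg_to (cvg_cst _) lim0); apply: nearW => n.
by rewrite (fE n) scale1r raddfD /= (Phi0 _ _ (bk n)) add0r; exact: op_normP.
Qed.

(** The two functionals live on disjoint parts of the space, the support of [x]
    and its complement. As the norm of [L1 mu] is the sum of the norms on these
    parts, the norm of the sum of the functionals is the larger of their
    norms. *)
Lemma norm_pairing_sg_add Phi (x : L1 mu) :
  (forall C k, bounded_by C k -> Phi (L1_mul k x) = 0) ->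
  `| `|Phi| *: pairing (fun t => Num.sg (L1_to_fun x t)) + Phi| <= `|Phi|.
Proof.
move=> Phi0; set S := [set t | L1_to_fun x t != 0].
have mS : measurable S := L1_measurable_support x.
have bS := bounded_by_indic R mS.
apply: op_norm_le => f f1.
apply: (@le_trans _ _ (`|Phi| * `|f|)); last by rewrite ler_piMr.
rewrite [X in `|X|](_ : _ =
  `|Phi| * pairing (fun t => Num.sg (L1_to_fun x t)) f + Phi f)//.
rewrite (le_trans (ler_normD _ _))//.
rewrite [in leRHS](L1_norm_split f mS) mulrDr lerD//.
  rewrite normrM normr_id ler_wpM2l// (pairingE f (bounded_by_sg x)).
  rewrite (le_trans (L1_int_norm _))//.
  apply: (L1_norm_mul_le f (bounded_by_sg x) bS) => t.
  have tS : (t \in S) = (L1_to_fun x t != 0) by apply/idP/idP; rewrite inE.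
  rewrite normr_sg indicE tS.
  by rewrite ger0_norm.
rewrite {1}(L1_mul_split f mS) raddfD /= (dual_vanish_on_support f Phi0) add0r.
exact: (op_normP Phi).
Qed.

End pairing.

(** * Convex decompositions in the bidual of L1 *)

Section convex_decomposition.
Context d (T : measurableType d) (R : realType).
Variable mu : {measure set T -> \bar R}.
Implicit Types (h k : T -> R) (Phi : dual (L1 mu)) (Y Z : bidual (L1 mu)).

Lemma bidual_le Y Phi c : `|Y| <= 1 -> `|Phi| <= c -> Y Phi <= c.
Proof.
move=> Y1 Phic; rewrite (le_trans (ler_norm _))// (le_trans (op_normP Y Phi))//.
by rewrite (le_trans _ Phic)// ler_piMl.
Qed.

Context (x : L1 mu).
Let s t := Num.sg (L1_to_fun x t).

Let bsk C k : bounded_by C k -> bounded_by C (fun t => s t * `|k t|).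
Proof.
move=> [mk kC]; have [ms s1] := bounded_by_sg x; split.
  by apply: measurable_funM => //; exact: measurableT_comp.
move=> t; rewrite normrM normr_id (le_trans _ (kC t))// ler_piMl//.
exact: s1.
Qed.

Section norming.
Context (Y : bidual (L1 mu)).
Hypotheses (Y1 : `|Y| <= 1) (Ys : Y (pairing mu s) = 1).

(** The function [C s - s |k| + k] is bounded by [C], whence
    [C - Y (pairing (s |k|)) + Y (pairing k) <= C]. *)
Lemma norming_pairing_le (C : R) k : 0 <= C -> bounded_by C k ->
  Y (pairing mu k) <= Y (pairing mu (fun t => s t * `|k t|)).
Proof.
move=> C0 kC; have [mk kC'] := kC; have [ms s1] := bounded_by_sg x.
have kl := bounded_by_lin (-1) (bsk kC) kC.
have hC : bounded_by C (fun t => C * s t + (-1 * (s t * `|k t|) + k t)).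
  split.
    apply: measurable_funD; first exact: measurable_funM.
    by case: kl.
  move=> t; rewrite (_ : _ + _ = s t * (C - `|k t|) + k t); last by ring.
  rewrite (le_trans (ler_normD _ _))// normrM.
  rewrite (@ger0_norm _ (C - _)) ?subr_ge0//.
  rewrite -lerBrDr ler_piMl ?subr_ge0//; exact: s1.
have := bidual_le Y1 (norm_pairing mu C0 hC).
rewrite (pairing_lin mu C (bounded_by_sg x) kl).
rewrite (pairing_lin mu (-1) (bsk kC) kC).
by rewrite !raddfD /= !linearZ /= Ys /GRing.scale /=; lra.
Qed.

Lemma norming_pairing_norm_le (C : R) k : 0 <= C -> bounded_by C k ->
  `|Y (pairing mu k)| <= Y (pairing mu (fun t => s t * `|k t|)).
Proof.
move=> C0 kC; have [mk kC'] := kC.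
have nkC : bounded_by C (fun t => - k t).
  by split=> [|t]; [exact: measurableT_comp|rewrite normrN].
rewrite ler_norml (norming_pairing_le C0 kC) andbT lerNl.
have := norming_pairing_le C0 nkC; rewrite (pairingN mu kC) raddfN /=.
move=> /le_trans; apply; rewrite le_eqVlt; apply/orP; left; apply/eqP.
by congr (Y (pairing mu _)); apply/funext => t; rewrite normrN.
Qed.

(** By [norm_pairing_sg_add], the functional [|Phi| pairing s + Phi] has norm at
    most [|Phi|]. The value of [Y] at its first term already equals [|Phi|], so
    its value at [Phi] cannot be positive; nor can its value at [- Phi]. *)
Lemma norming_vanish Phi :
  (forall C k, bounded_by C k -> Phi (L1_mul k x) = 0) -> Y Phi = 0.
Proof.
have le0 (Psi : dual (L1 mu)) :
    (forall C k, bounded_by C k -> Psi (L1_mul k x) = 0) -> Y Psi <= 0.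
  move=> /norm_pairing_sg_add /(bidual_le Y1).
  by rewrite raddfD /= linearZ /= Ys /GRing.scale /= mulr1; lra.
move=> Phi0; apply/eqP; rewrite eq_le le0//= -oppr_le0 -raddfN.
apply: le0 => C k kC.
by rewrite -[LHS]/(- Phi (L1_mul k x)) (Phi0 _ _ kC) oppr0.
Qed.

End norming.

Context (Y Z : bidual (L1 mu)) (t : R).
Hypotheses (Y1 : `|Y| <= 1) (Z1 : `|Z| <= 1) (t0 : 0 < t) (t1 : t < 1).
Hypotheses (x1 : `|x| = 1)
  (xYZ : forall Phi, Phi x = t * Y Phi + (1 - t) * Z Phi).

(** The convex combination of two numbers at most 1 can be 1, the value [|x|] of
    [pairing s] at [x], only if both are 1. *)
Lemma convex_norming : Y (pairing mu s) = 1 /\ Z (pairing mu s) = 1.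
Proof.
have s1 := norm_pairing mu ler01 (bounded_by_sg x).
have := xYZ (pairing mu s).
rewrite (pairingE x (bounded_by_sg x)) L1_int_sg x1.
have := bidual_le Y1 s1; have := bidual_le Z1 s1.
move: (Y _) (Z _) => a b b1 a1 ab.
have ta : 0 <= t * (1 - a) by rewrite mulr_ge0// ?subr_ge0// ltW.
have tb : 0 <= (1 - t) * (1 - b) by rewrite mulr_ge0// subr_ge0// ltW.
have /eqP : t * (1 - a) = 0 by lra.
have /eqP : (1 - t) * (1 - b) = 0 by lra.
rewrite !mulf_eq0 !subr_eq0 (gt_eqF t0) (gt_eqF t1).
by move=> /eqP <- /eqP <-.
Qed.

(** Both [Y] and [Z] are nonnegative at [pairing (s |k|)], where their convex
    combination is the integral of [s |k| x = |k x|]. *)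
Lemma convex_dominated (C : R) k : 0 <= C -> bounded_by C k ->
  `|Y (pairing mu k)| <= t^-1 * `|L1_mul k x|.
Proof.
move=> C0 kC; have [Ys Zs] := convex_norming.
rewrite mulrC ler_pdivlMr// mulrC.
have := xYZ (pairing mu (fun t => s t * `|k t|)).
rewrite (pairingE x (bsk kC)) (L1_int_sg_mul x kC) => ->.
have := norming_pairing_norm_le Y1 Ys C0 kC.
have := norming_pairing_norm_le Z1 Zs C0 kC.
have Zk := normr_ge0 (Z (pairing mu k)).
move=> /(le_trans Zk) Z0 Yk; rewrite (le_trans (ler_wpM2l (ltW t0) Yk))//.
by rewrite lerDl mulr_ge0// subr_ge0 ltW.
Qed.

(** The densities [g] of [Y] and [h] of [Phi] both come from [bounded_density];
    the product of [h] with [g x] and that of [g] with [h x] have the same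
    integral, which is [Y Phi] on one side and [Phi (g x)] on the other. *)
Theorem convex_component_in_L1 : exists w, forall Phi, Y Phi = Phi w.
Proof.
have [Ys _] := convex_norming.
have [g gb gE] : exists2 g, bounded_by t^-1 g & forall D h, bounded_by D h ->
    Y (pairing mu h) = L1_int (L1_mul h (L1_mul g x)).
  apply: (@bounded_density _ _ _ mu x (fun h => Y (pairing mu h))) => //.
  - by rewrite invr_ge0 ltW.
  - move=> a h k C D hC kD; rewrite (pairing_lin mu a hC kD).
    by rewrite raddfD /= linearZ.
  - move=> D h hD; apply: (@convex_dominated `|D|) => //.
    by case: hD => mh hD; split => // u; rewrite (le_trans (hD u))// ler_norm.
exists (L1_mul g x) => Phi.
have [h hb hE] : exists2 h, bounded_by `|Phi| h & forall D k, bounded_by D k ->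
    Phi (L1_mul k x) = L1_int (L1_mul k (L1_mul h x)).
  apply: (@bounded_density _ _ _ mu x (fun k => Phi (L1_mul k x))) => //.
  - move=> a k l C D kC lD; rewrite (L1_mul_linl a x kC lD).
    by rewrite raddfD /= linearZ.
  - by move=> D k kD; exact: op_normP.
have -> : Y Phi = Y (pairing mu h).
  apply/eqP; rewrite -subr_eq0 -raddfB; apply/eqP.
  apply: (norming_vanish Y1 Ys) => C k kC.
  rewrite -[LHS]/(Phi (L1_mul k x) - pairing mu h (L1_mul k x)).
  rewrite (hE _ _ kC) (pairingE _ hb) (L1_mul_mul x kC hb) (L1_mul_mul x hb kC).
  rewrite (_ : k \* h = h \* k) ?subrr//.
  by apply/funext => u /=; rewrite mulrC.
rewrite (gE _ _ hb) (hE _ _ gb) (L1_mul_mul x gb hb) (L1_mul_mul x hb gb).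
by congr (L1_int (L1_mul _ x)); apply/funext => u /=; rewrite mulrC.
Qed.

End convex_decomposition.

(** * Extreme points of subspaces of L1 *)

Lemma L1_subspace_component (R : realType) (d : measure_display)
    (T : measurableType d) (mu : {measure set T -> \bar R})
    (X : submodClosed (L1 mu)) (x : subspace_of X)
    (y z : bidual (subspace_of X)) (t : R) :
  closed [set` X] -> `|x| = 1 -> `|y| <= 1 -> `|z| <= 1 -> 0 < t -> t < 1 ->
  to_bidual x = t *: y + (1 - t) *: z -> exists u, y = to_bidual u.
Proof.
move=> cX x1 y1 z1 t0 t1 xyz.
have [Y YE Yy] := bidual_push y; have [Z ZE Zz] := bidual_push z.
have [|||w wE] := @convex_component_in_L1 d T R mu (val x) Y Z t _ _ t0 t1 x1.
- exact: le_trans y1.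
- exact: le_trans z1.
- move=> Phi; rewrite YE ZE -restrictionE.
  exact: (congr1 (fun F : bidual (subspace_of X) => F (restriction X Phi)) xyz).
by apply: (bidual_in_subspace (w := w) cX) => Phi; rewrite -YE.
Qed.

Theorem theorem4p4 (R : realType) (d : measure_display) (T : measurableType d)
    (mu : {measure set T -> \bar R})
    (X : submodClosed (L1 mu)) (closedX : closed [set` X])
    (x : subspace_of X) :
  extreme_point (unit_ball (subspace_of X)) x -> preserved_extreme_point x.
Proof.
move=> xext; have [xball xE] := xext; split=> //; split.
  by rewrite /unit_ball/= norm_to_bidual.
move=> y z t y1 z1 t0 t1 xyz.
have [X0|x1] := extreme_point_unit_ball xext.
  have bidual0 (F G : bidual (subspace_of X)) : F = G.
    apply: dual_ext => phi; suff -> : phi = 0 by rewrite !raddf0.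
    by apply: dual_ext => u; rewrite (X0 u) !raddf0.
  by split; exact: bidual0.
have [u yu] := L1_subspace_component closedX x1 y1 z1 t0 t1 xyz.
have [v zv] : exists v, z = to_bidual v.
  apply: (@L1_subspace_component _ _ _ _ _ x z y (1 - t)) => //.
  - by rewrite subr_gt0.
  - by rewrite ltrBlDr ltrDl.
  - by rewrite subKr addrC.
have [u1 v1] : `|u| <= 1 /\ `|v| <= 1.
  by rewrite -(norm_to_bidual u) -(norm_to_bidual v) -yu -zv.
have xuv : x = t *: u + (1 - t) *: v.
  apply: to_bidual_inj; apply: dual_ext => phi; rewrite xyz yu zv.
  rewrite -[RHS]/(phi (t *: u + (1 - t) *: v)) raddfD /= !linearZ.
  by [].
by rewrite yu zv; have [-> ->] := xE u v t u1 v1 t0 t1 xuv.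
Qed.
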